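(* There exist disjoint sets $H_0,H_1\subset\mathcal E$ of stationary ergodic binary process laws such that (i) there exists a weakly asymptotically consistent test for $H_0$ against $H_1$; (ii) there exists no strongly asymptotically consistent test for $H_0$ against $H_1$. Consequently, weak asymptotic consistency does not imply strong asymptotic consistency for arbitrary pairs of stationary ergodic hypotheses; that is, the assertion ''for every pair of disjoint sets $H_0,H_1\subset\mathcal E$, the existence of a weakly asymptotically consistent test implies the existence of a strongly asymptotically consistent test'' is false.
   Context: $\mathbb N=\{1,2,3,\ldots\}$. $\mathcal X=\{0,1\}^{\mathbb N}$ carries its product Borel sigma-field, and $T:\mathcal X\to\mathcal X$, $(Tx)_i=x_{i+1}$, is the left shift. $\mathcal E$ is the set of all $T$-invariant and $T$-ergodic Borel probability measures on $\mathcal X$, where a $T$-invariant probability measure $P$ is $T$-ergodic when every Borel set $A$ with $P(A\mathbin\triangle T^{-1}A)=0$ has $P(A)\in\{0,1\}$. For $x\in\mathcal X$ write $x_1^n=(x_1,\ldots,x_n)$. A test is a sequence of (measurable) functions $\varphi_n:\{0,1\}^n\to\{0,1\}$, $n\in\mathbb N$. Let $H_0,H_1\subset\mathcal E$ be disjoint; they need not exhaust $\mathcal E$, and no measurability or topological condition is imposed on them as subsets of the space of probability laws. The test $(\varphi_n)$ is weakly asymptotically consistent for $H_0$ against $H_1$ if for every $i\in\{0,1\}$ and every $\rho\in H_i$, $\rho\{x:\varphi_n(x_1^n)\ne i\}\to0$ as $n\to\infty$. It is strongly asymptotically consistent for $H_0$ against $H_1$ if for every $i\in\{0,1\}$ and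 every $\rho\in H_i$, $\rho\{x:\exists N\in\mathbb N\ \forall n\ge N,\ \varphi_n(x_1^n)=i\}=1$. No rate and no uniformity over the hypotheses is required. *)

(* Defs.v *)
From HB Require Import structures.
From mathcomp Require Import all_boot all_order all_algebra.
From mathcomp Require Import all_classical all_reals all_analysis.

Set Implicit Arguments.
Unset Strict Implicit.
Unset Printing Implicit Defensive.

Import Order.TTheory GRing.Theory Num.Theory.
Import numFieldNormedType.Exports.

Local Open Scope classical_set_scope.
Local Open Scope ring_scope.

(* Sequences are indexed from 0: the coordinate written x_i in the mathematical
   text (i = 1, 2, ...) is [x i.-1]. *)
Definition coordinate_events : set (set (nat -> bool)) :=
  \bigcup_(i in [set: nat])
    preimage_set_system setT (fun x : nat -> bool => x i) measurable.

(* {0,1}^N with the sigma-algebra generated by the coordinate maps, which, the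
   product being countable, is also the Borel one of the product topology. *)
Definition binary_sequence := g_sigma_algebraType coordinate_events.

Definition process_law (R : realType) := probability binary_sequence R.

Definition left_shift (x : binary_sequence) : binary_sequence :=
  fun i => x i.+1.

Definition initial_block (n : nat) (x : binary_sequence) : n.-tuple bool :=
  [tuple x i | i < n].

Definition stationary (R : realType) (P : process_law R) : Prop :=
  forall A : set binary_sequence, measurable A -> P (left_shift @^-1` A) = P A.

Definition ergodic (R : realType) (P : process_law R) : Prop :=
  forall A : set binary_sequence, measurable A ->
    P (A `+` left_shift @^-1` A) = 0%E -> P A = 0%E \/ P A = 1%E.

Definition stationary_ergodic (R : realType) : set (process_law R) :=
  [set P | stationary P /\ ergodic P].

Arguments stationary_ergodic R : clear implicits.

(* The component at n = 0 is junk: consistency is insensitive to it. *)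
Definition test := forall n : nat, {mfun n.-tuple bool >-> bool}.

(* [false] and [true] stand for the hypothesis indices 0 and 1. *)
Definition hypothesis (R : realType) (H0 H1 : set (process_law R)) (i : bool) :
    set (process_law R) :=
  if i then H1 else H0.

Definition weakly_consistent (R : realType) (H0 H1 : set (process_law R))
    (phi : test) : Prop :=
  forall (i : bool) (rho : process_law R), hypothesis H0 H1 i rho ->
    rho [set x | phi n (initial_block n x) <> i] @[n --> \oo] --> 0%E.

Definition strongly_consistent (R : realType) (H0 H1 : set (process_law R))
    (phi : test) : Prop :=
  forall (i : bool) (rho : process_law R), hypothesis H0 H1 i rho ->
    rho [set x | exists N : nat, forall n : nat, (N <= n)%N ->
                   phi n (initial_block n x) = i] = 1%E.

(* Main.v *)
Require Import Defs.
From HB Require Import structures.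
From mathcomp Require Import all_boot all_order all_algebra.
From mathcomp Require Import all_classical all_reals all_analysis.
From mathcomp Require Import zify lra.

(** Every process used here is a coding of the dyadic odometer. Adding 1 to a
    2-adic integer preserves coin tossing and is ergodic, so that for each
    measurable [f] the sequence [f z, f (z + 1), f (z + 2), ...] with [z]
    uniform has a stationary and ergodic law ([coded_law_stationary_ergodic]).

    Fix scales [l 0 < l 1 < ...]. At each multiple of [2 ^ l j] the full
    pattern has a mark of stage [j], a run of [2 ^ s - 1] ones. The exponent
    [s] is [2 * j + 2], except on the odd part of stage [j], an initial
    fraction [2 ^- rarity j] (of the order of [1 / j]) of each interval between
    two consecutive multiples of [2 ^ l j.+1], where it is [2 * j + 1]. Marks
    cannot merge ([pattern_run_break]), so the longest run of ones in a window
    reveals the largest exponent seen, and the parity test answers with its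
    parity. The pattern cut at stage [k] repeats what is seen in the odd part
    of stage [k] for ever. It is periodic and its largest exponent is odd: it
    belongs to the hypothesis of index 1 ([cut_pattern_class]). On the full
    pattern the parity test is wrong at time [n] only if the window starts in
    one of the two odd parts whose stages are comparable with [n], or if it
    meets a later stage or ends inside a mark, both of which are unlikely. As
    the odd parts get rare, the error probability tends to 0, and the full
    pattern belongs to the hypothesis of index 0 ([parity_error_cvg]).

    A strongly consistent test would settle on the answer 1 for the pattern cut
    at stage [k], after a time [N k] that is uniform by periodicity
    ([decision_threshold]). Choose [l k.+1] much larger than [N k]. A point in
    the first half of the odd part of stage [k] then sees nothing but the cut
    pattern up to time [N k], and the test says 1 at that time. The odd halves
    of different stages are independent and their probabilities have a
    divergent sum, so almost every point meets infinitely many of them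
    ([haar_missed_forever]) and the test does not settle on 0 for the full
    pattern: rare errors at every stage are compatible with weak consistency
    but not with strong consistency. *)

Set Implicit Arguments.
Unset Strict Implicit.
Unset Printing Implicit Defensive.

Import Order.TTheory GRing.Theory Num.Theory.
Import numFieldNormedType.Exports.

Local Open Scope classical_set_scope.

(** * Events that depend on finitely many coordinates *)

Lemma mfun_of_measurable d1 d2 (X : measurableType d1) (Y : measurableType d2)
    (g : X -> Y) :
  measurable_fun [set: X] g -> exists f : {mfun X >-> Y}, f = g :> (X -> Y).
Proof.
move=> mg.
pose f : {mfun X >-> Y} := HB.pack g (isMeasurableFun.Build _ _ _ _ g mg).
by exists f.
Qed.

Lemma measurable_coordinate (i : nat) :
  measurable_fun [set: binary_sequence] (fun x : binary_sequence => x i).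
Proof.
move=> _ B mB; rewrite setTI; apply: sub_sigma_algebra.
by exists i => //; exists B => //; rewrite setTI.
Qed.

Lemma measurable_coordinatewise d (X : measurableType d)
    (F : X -> binary_sequence) :
  (forall i, measurable_fun [set: X] (fun x => F x i)) ->
  measurable_fun [set: X] F.
Proof.
move=> mF.
apply: (@measurability _ _ _ binary_sequence _ _ coordinate_events) => //.
by move=> _ [_ [i _ [B mB <-]] <-]; rewrite !setTI -[_ @^-1` _]setTI; exact: mF.
Qed.

Lemma measurable_tuple_set n (A : set (n.-tuple bool)) : measurable A.
Proof.
apply: countable_measurable => [t|]; last exact: countableP.
have -> : [set t] = \bigcap_(i : 'I_n)
    ((fun s : n.-tuple bool => tnth s i) @^-1` [set tnth t i]).
  apply/seteqP; split => [s -> //|s st]; apply: eq_from_tnth => i.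
  by have := st i Logic.I.
apply: fin_bigcap_measurable => [|i _]; first exact: finite_finset.
rewrite -[_ @^-1` _]setTI.
exact: measurable_tnth.
Qed.

Lemma measurable_initial_block n :
  measurable_fun [set: binary_sequence] (initial_block n).
Proof.
apply/measurable_fun_tnthP => i.
rewrite (_ : _ \o _ = fun x : binary_sequence => x i).
  exact: measurable_coordinate.
by apply/funext => x /=; rewrite tnth_mktuple.
Qed.

Lemma measurable_cylinder n (D : set (n.-tuple bool)) :
  measurable [set x : binary_sequence | D (initial_block n x)].
Proof.
rewrite -[X in measurable X]setTI; apply: measurable_initial_block => //.
exact: measurable_tuple_set.
Qed.

Lemma measurable_eventually (phi : test) i : measurable
  [set x : binary_sequence |
    exists N, forall n, N <= n -> phi n (initial_block n x) = i].
Proof.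
rewrite (_ : [set _ | _] = \bigcup_N \bigcap_(n in [set n | N <= n])
    [set x | phi n (initial_block n x) = i]).
  apply: bigcupT_measurable => N; apply: bigcap_measurableType => n _.
  exact: (measurable_cylinder [set w | phi n w = i]).
by apply/seteqP; split=> x [N]; exists N.
Qed.

(** Such an event is a preimage under [initial_block n], and all sets of
    tuples of booleans are measurable. *)
Lemma measurable_finitary n (A : set binary_sequence) :
  (forall x y, (forall i, (i < n)%N -> x i = y i) -> A x -> A y) ->
  measurable A.
Proof.
move=> finA.
have -> : A = initial_block n @^-1` (initial_block n @` A).
  apply/seteqP; split => [x Ax|x [y Ay yx]]; first by exists x.
  apply: finA Ay => i ltin; have := congr1 (fun t => tnth t (Ordinal ltin)) yx.
  by rewrite !tnth_mktuple.
by rewrite -[_ @^-1` _]setTI; apply: measurable_initial_block;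
  [|exact: measurable_tuple_set].
Qed.

(** * The dyadic odometer *)

(** The residue modulo [2 ^ l] of the 2-adic integer with digits [z]. *)
Definition residue (l : nat) (z : binary_sequence) : nat :=
  \sum_(j < l) z j * 2 ^ j.

Lemma residueS l z : residue l.+1 z = residue l z + z l * 2 ^ l.
Proof. by rewrite /residue big_ord_recr. Qed.

Lemma residue_lt l z : residue l z < 2 ^ l.
Proof.
elim: l => [|l IHl]; first by rewrite /residue big_ord0.
by rewrite residueS expnS; case: (z l); lia.
Qed.

Lemma residue_mod m l z : m <= l -> residue l z %% 2 ^ m = residue m z.
Proof.
move=> /subnK <-; elim: (l - m) => [|k IHk].
  by rewrite modn_small ?residue_lt.
by rewrite addSn residueS expnD mulnA addnC modnMDl.
Qed.

Lemma eq_residue_le m l y z : m <= l -> residue l y = residue l z ->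
  residue m y = residue m z.
Proof. by move=> ml yz; rewrite -!(residue_mod _ ml) yz. Qed.

Lemma digit_residue l z : z l = odd (residue l.+1 z %/ 2 ^ l).
Proof.
rewrite residueS addnC divnMDl ?expn_gt0// divn_small ?residue_lt// addn0.
by case: (z l).
Qed.

Lemma eq_residueP l x y :
  (forall i, i < l -> x i = y i) <-> residue l x = residue l y.
Proof.
split=> [xy|xy i il]; first by apply: eq_bigr => i _; rewrite xy.
by rewrite (digit_residue i x) (digit_residue i y) -!(residue_mod _ il) xy.
Qed.

Lemma modn_expnS n l :
  n %% 2 ^ l.+1 = n %% 2 ^ l + odd (n %/ 2 ^ l) * 2 ^ l.
Proof.
have q2 := divn_eq (n %/ 2 ^ l) 2; rewrite modn2 in q2.
rewrite {1}(divn_eq n (2 ^ l)) {1}q2 mulnDl -mulnA -expnS -addnA modnMDl addnC.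
have : n %% 2 ^ l < 2 ^ l by rewrite ltn_mod expn_gt0.
by move=> lt; rewrite modn_small//; rewrite expnS; case: (odd _); lia.
Qed.

Lemma residue_digits l w n :
  (forall j, j < l -> w j = odd (n %/ 2 ^ j)) -> residue l w = n %% 2 ^ l.
Proof.
elim: l => [|l IHl] wn; first by rewrite /residue big_ord0 modn1.
rewrite residueS IHl => [|j jl]; last by apply: wn; exact: ltnW.
by rewrite wn// modn_expnS.
Qed.

Lemma measurable_residue_set l (B : set nat) :
  measurable [set z | B (residue l z)].
Proof. by apply: (@measurable_finitary l) => x y /eq_residueP /= ->. Qed.

(** Addition of 1 in the 2-adic integers. Digit [j] of the sum only depends on
    the residue modulo [2 ^ j.+1], so it can be read off without carries. *)
Definition odometer (z : binary_sequence) : binary_sequence :=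
  fun j => odd ((residue j.+1 z).+1 %/ 2 ^ j).

Lemma residue_odometer l z : residue l (odometer z) = (residue l z).+1 %% 2 ^ l.
Proof.
apply: residue_digits => j jl; rewrite /odometer -(residue_mod _ jl).
move: (residue l z) => n; rewrite {2}(divn_eq n (2 ^ j.+1)).
rewrite -[in RHS]addnS divnDl; last by rewrite expnS mulnA dvdn_mull.
by rewrite oddD expnS mulnA mulnK ?expn_gt0// oddM andbF.
Qed.

Lemma residue_iter_odometer l i z :
  residue l (iter i odometer z) = (residue l z + i) %% 2 ^ l.
Proof.
elim: i => [|i IHi]; first by rewrite addn0 modn_small ?residue_lt.
by rewrite iterS residue_odometer IHi -addn1 modnDml addn1 addnS.
Qed.

Lemma residue_shift l i z : residue l z + i < 2 ^ l ->
  residue l (iter i odometer z) = residue l z + i.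
Proof. by move=> ?; rewrite residue_iter_odometer modn_small. Qed.

Lemma measurable_odometer : measurable_fun [set: binary_sequence] odometer.
Proof.
apply: measurable_coordinatewise => i _ B mB; rewrite setTI.
apply: (@measurable_finitary i.+1) => x y /eq_residueP.
by rewrite /= /odometer => ->.
Qed.

HB.instance Definition _ := isMeasurableFun.Build _ _ _ _ odometer
  measurable_odometer.

Definition residue_sets : set (set binary_sequence) :=
  [set A | exists l p, A = [set z | residue l z = p]].

(** A coordinate event is a countable union of residue classes. *)
Lemma measurable_residue_sets :
  (measurable : set (set binary_sequence)) = <<s residue_sets >>.
Proof.
apply/seteqP; split.
  apply: smallest_sub; first exact: smallest_sigma_algebra.
  move=> _ [i _ [B _ <-]]; rewrite setTI.
  have -> : (fun x : nat -> bool => x i) @^-1` B =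
      \bigcup_(p in [set p | B (odd (p %/ 2 ^ i))]) [set z | residue i.+1 z = p].
    apply/seteqP; split=> z /=.
      by rewrite (digit_residue i z) => Bz; exists (residue i.+1 z).
    by move=> [p Bp zp]; rewrite (digit_residue i z) zp.
  rewrite bigcup_mkcond; apply: sigma_algebra_bigcup => p.
  case: ifPn => _; last exact: sigma_algebra0.
  by apply: sub_sigma_algebra; exists i.+1, p.
apply: smallest_sub; first exact: sigma_algebra_measurable.
by move=> _ [l [p ->]]; exact: (measurable_residue_set l [set p]).
Qed.

(** Two residue classes are nested or disjoint; the empty intersection is the
    class of 1 modulo [2 ^ 0]. *)
Lemma setI_closed_residue_sets : setI_closed residue_sets.
Proof.
have main l p m q : (l <= m)%N ->
    residue_sets ([set z | residue l z = p] `&` [set z | residue m z = q]).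
  move=> lm; have [qp|qp] := eqVneq (q %% 2 ^ l)%N p.
    exists m, q; apply/seteqP; split=> z /=; first by case.
    by move=> zq; rewrite -(residue_mod z lm) zq.
  exists 0%N, 1%N; apply/seteqP; split=> z /=.
    by rewrite -(residue_mod z lm) => -[+ zq]; rewrite zq => /eqP; rewrite (negbTE qp).
  by rewrite /residue big_ord0.
move=> _ _ [l [p ->]] [m [q ->]]; have [|/ltnW] := leqP l m; first exact: main.
by rewrite setIC; exact: main.
Qed.

(** The itinerary of [z] under the odometer, seen through [f]. *)
Definition coding (f : binary_sequence -> bool) (z : binary_sequence) :
  binary_sequence := fun i => f (iter i odometer z).

Lemma left_shift_coding f z : left_shift (coding f z) = coding f (odometer z).
Proof. by apply/funext => i; rewrite /left_shift /coding iterSr. Qed.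

Lemma measurable_iter_odometer i :
  measurable_fun [set: binary_sequence] (iter i odometer).
Proof.
elim: i => [|i IHi]; first exact: measurable_id.
exact: measurableT_comp measurable_odometer IHi.
Qed.

Lemma measurable_coding (f : {mfun binary_sequence >-> bool}) :
  measurable_fun [set: binary_sequence] (coding f).
Proof.
apply: measurable_coordinatewise => i.
by apply: measurableT_comp => //; exact: measurable_iter_odometer.
Qed.

HB.instance Definition _ (f : {mfun binary_sequence >-> bool}) :=
  isMeasurableFun.Build _ _ _ _ (coding f) (measurable_coding f).

(** * Haar measure and the laws of codings *)

Section haar.
Variable R : realType.

Definition unit_interval_length : set (measurableTypeR R) -> \bar R :=
  mrestr (@lebesgue_measure R) (measurable_itv (`[0, 1[)%R).

HB.instance Definition _ := Measure.on unit_interval_length.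

Lemma unit_interval_length_setT : unit_interval_length setT = 1%E.
Proof.
rewrite /unit_interval_length /mrestr setTI lebesgue_measure_itv /=.
by rewrite lte_fin ltr01 oppr0 adde0.
Qed.

HB.instance Definition _ := Measure_isProbability.Build _ _ _
  unit_interval_length unit_interval_length_setT.

Definition binary_digits (x : measurableTypeR R) : binary_sequence :=
  fun j => odd (Num.truncn (2 ^+ j.+1 * x)%R).

Lemma truncn_half (y : R) : (0 <= y)%R ->
  Num.truncn (2 * y)%R = (odd (Num.truncn (2 * y)%R) + (Num.truncn y).*2)%N.
Proof.
move=> y0; rewrite -[LHS]odd_double_half; congr (_ + _.*2)%N.
apply/esym/truncn_def.
have /truncn_itv : (0 <= 2 * y)%R by lra.
move: (Num.truncn _) => t; rewrite -!natr1 => /andP[ty yt].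
have tE : (t%:R = (odd t)%:R + 2 * (t./2)%:R :> R)%R.
  by rewrite -natrM -natrD mul2n odd_double_half.
have odd_ge0 : (0 <= (odd t)%:R :> R)%R by rewrite ler0n.
have odd_le1 : ((odd t)%:R <= 1 :> R)%R by rewrite lern1 leq_b1.
by apply/andP; split; lra.
Qed.

(** Reversing the order of the digits turns a residue class modulo [2 ^ l] into
    a dyadic interval of length [2 ^- l]: the residue uses the first binary
    digit of [x] as its lowest digit, the integer part of [2 ^+ l * x] uses it
    as its highest one. *)
Lemma residue_binary_digits l (p : nat) : (p < 2 ^ l)%N ->
  exists2 m : nat, (m < 2 ^ l)%N & forall x : R, (0 <= x < 1)%R ->
    residue l (binary_digits x) = p <-> Num.truncn (2 ^+ l * x)%R = m.
Proof.
elim: l p => [|l IHl] p plt.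
  exists 0%N => // x /andP[x0 x1]; rewrite expr0 mul1r /residue big_ord0.
  by move: plt; rewrite expn0 ltnS leqn0 => /eqP ->; rewrite (@truncn_def _ x 0%N)// x0.
have [m mlt Hm] := IHl (p %% 2 ^ l)%N (ltac:(by rewrite ltn_mod expn_gt0)).
exists (odd (p %/ 2 ^ l) + m.*2)%N.
  by move: mlt; rewrite expnS; case: odd; lia.
move=> x x01; have x0 : (0 <= 2 ^+ l * x)%R.
  by case/andP: x01 => *; rewrite mulr_ge0 ?exprn_ge0.
have plt2 : (p %/ 2 ^ l < 2)%N by rewrite ltn_divLR ?expn_gt0// -expnS.
rewrite residueS.
have -> : binary_digits x l = odd (Num.truncn (2 * (2 ^+ l * x))%R).
  by rewrite /binary_digits exprS mulrA.
rewrite exprS -mulrA truncn_half//.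
move: (odd (Num.truncn _)) => b; have := Hm x x01.
set r := residue l _; set t := Num.truncn _ => rt.
have rl : (r < 2 ^ l)%N := residue_lt _ _.
have [c qc] : exists c : bool, (p %/ 2 ^ l = c)%N.
  by exists (odd (p %/ 2 ^ l)); move: plt2; case: (_ %/ _)%N => [|[]].
rewrite {1}(divn_eq p (2 ^ l)) qc oddb.
have pl : (p %% 2 ^ l < 2 ^ l)%N by rewrite ltn_mod expn_gt0.
rewrite oddD odd_double addbF oddb; split=> [E|E].
  have [rp bc] : r = (p %% 2 ^ l)%N /\ b = c.
    by move: E; case: b; case: (c); lia.
  by rewrite bc (proj1 rt).
have [tm bc] : t = m /\ b = c.
  have : odd (b + t.*2) = odd (c + m.*2) by rewrite E.
  rewrite !oddD !odd_double !addbF !oddb => bc; split=> //.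
  by move: E; rewrite bc => /addnI; exact: double_inj.
by rewrite bc (proj2 rt tm) addnC.
Qed.

Lemma measurable_binary_digits : measurable_fun [set: R] binary_digits.
Proof.
apply: measurable_coordinatewise => i; apply: (measurable_fun_bool true).
rewrite setTI.
have -> : (binary_digits ^~ i) @^-1` [set true] =
    \bigcup_(k in [set k | odd k]) `[(k%:R / 2 ^+ i.+1)%R, (k.+1%:R / 2 ^+ i.+1)%R[.
  apply/seteqP; split=> x /=; rewrite /binary_digits.
    move=> ox; exists (Num.truncn (2 ^+ i.+1 * x)%R) => //=.
    have x0 : (0 <= 2 ^+ i.+1 * x)%R.
      rewrite leNgt; apply: contraPN ox => x0; rewrite (truncn0Pn _ _)//.
      by rewrite -ltNge; lra.
    have /andP[t1 t2] := truncn_itv x0.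
    rewrite in_itv /= ler_pdivrMr ?exprn_gt0// ltr_pdivlMr ?exprn_gt0//.
    by rewrite [(x * _)%R]mulrC t1.
  move=> [k /= ok].
  rewrite in_itv /= ler_pdivrMr ?exprn_gt0// ltr_pdivlMr ?exprn_gt0//.
  by rewrite [(x * _)%R]mulrC => /truncn_def ->.
by apply: bigcup_measurable => k _; exact: measurable_itv.
Qed.

HB.instance Definition _ := isMeasurableFun.Build _ _ _ _ binary_digits
  measurable_binary_digits.

(** Coin tossing, as the law of the binary digits of a uniform point. *)
Lemma exists_haar : exists mu : process_law R, forall l p, (p < 2 ^ l)%N ->
  mu [set z | residue l z = p] = (2 ^- l)%:E.
Proof.
exists (distribution unit_interval_length
  (binary_digits : {mfun measurableTypeR R >-> binary_sequence})) => l p plt.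
have [m mlt Hm] := residue_binary_digits plt.
rewrite /distribution /pushforward /= /unit_interval_length /mrestr.
have l0 : (0 < 2 ^+ l :> R)%R by rewrite exprn_gt0.
have -> : (binary_digits @^-1` [set z | residue l z = p]) `&` `[0%R, 1%R[ =
    `[(m%:R / 2 ^+ l)%R, (m.+1%:R / 2 ^+ l)%R[.
  apply/seteqP; split=> x /=; rewrite !in_itv /= ler_pdivrMr// ltr_pdivlMr//.
    move=> [/[swap] x01]; rewrite [(x * _)%R]mulrC Hm// => <-; apply: truncn_itv.
    by case/andP: x01 => *; rewrite mulr_ge0 ?exprn_ge0.
  rewrite [(x * _)%R]mulrC => /andP[mx xm].
  have x01 : (0 <= x < 1)%R.
    rewrite -(pmulr_rge0 x l0) (le_trans (ler0n _ m) mx) -(ltr_pM2l l0) mulr1 /=.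
    by apply: (lt_le_trans xm); rewrite -natrX ler_nat.
  by split=> //; apply/Hm => //; apply: truncn_def; rewrite mx.
rewrite lebesgue_measure_itv /= lte_fin ltr_pM2r ?invr_gt0// ltr_nat ltnSn.
by rewrite -EFinB -mulrBl -natrB// subSnn mul1r.
Qed.

Definition haar : process_law R := projT1 (cid exists_haar).

Lemma haar_residue l (p : nat) : (p < 2 ^ l)%N ->
  haar [set z | residue l z = p] = (2 ^- l)%:E.
Proof. exact: projT2 (cid exists_haar) l p. Qed.

Lemma measure_residue_sum (nu : measure binary_sequence R) l
    (B : pred nat) :
  nu [set z | B (residue l z)] =
  (\sum_(0 <= p < 2 ^ l | B p) nu [set z | residue l z = p])%E.
Proof.
have -> : [set z | B (residue l z)] =
    [set z | B (residue l z) && (residue l z < 2 ^ l)%N].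
  by apply/seteqP; split=> z /=; rewrite residue_lt andbT.
elim: (2 ^ l)%N => [|m IHm].
  rewrite big_geq// (_ : [set _ | _] = set0) ?measure0//.
  by apply/seteqP; split=> z //=; rewrite andbF.
rewrite big_mkcond big_nat_recr//= -big_mkcond -IHm.
have ltSE r : (r < m.+1)%N = (r == m) || (r < m)%N by rewrite ltnS leq_eqVlt.
case: ifPn => Bm; last first.
  rewrite adde0; congr (nu _); apply/seteqP; split=> z /=; rewrite ltSE.
    by move=> /andP[Bz /orP[/eqP zm|->]]; [move: Bm; rewrite -zm Bz|rewrite Bz].
  by move=> /andP[-> ->]; rewrite orbT.
rewrite -measureU.
- congr (nu _); apply/seteqP; split=> z /=; rewrite ltSE.
    by move=> /andP[Bz /orP[/eqP zm|->]]; [right|left; rewrite Bz].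
  by move=> [/andP[-> ->]|->]; rewrite ?orbT// Bm eqxx.
- exact: (measurable_residue_set l [set p | B p && (p < m)%N]).
- exact: (measurable_residue_set l [set m]).
- by apply/seteqP; split=> z //= [/andP[_ +] zm]; rewrite zm ltnn.
Qed.

Lemma haar_residue_set l (B : pred nat) :
  haar [set z | B (residue l z)] =
  ((count B (iota 0 (2 ^ l)))%:R / 2 ^+ l)%:E.
Proof.
rewrite measure_residue_sum big_seq_cond (eq_bigr (fun=> (2 ^- l)%:E)).
  rewrite -big_seq_cond sumEFin big_const_seq iter_addr_0 mulr_natl.
  by rewrite /index_iota subn0.
by move=> p; rewrite mem_index_iota /= => /andP[pl _]; exact: haar_residue.
Qed.

Lemma measure_residue_unique (m1 m2 : measure binary_sequence R) :
    (m1 setT < +oo)%E ->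
    (forall l p, (p < 2 ^ l)%N ->
      m1 [set z | residue l z = p] = m2 [set z | residue l z = p]) ->
  forall A, measurable A -> m1 A = m2 A.
Proof.
move=> m1T m12; apply: (measure_unique residue_sets (fun=> setT)) => //.
- exact: measurable_residue_sets.
- exact: setI_closed_residue_sets.
- move=> _; exists 0%N, 0%N; apply/seteqP; split=> z //= _.
  by rewrite /residue big_ord0.
- exact: bigcup_const.
- move=> _ [l [p ->]]; have [pl|pl] := ltnP p (2 ^ l); first exact: m12.
  rewrite (_ : [set _ | _] = set0) ?measure0//.
  apply/seteqP; split=> z //= zp.
  by move: (residue_lt l z); rewrite zp ltnNge pl.
Qed.

(** Adding 1 permutes the residue classes modulo [2 ^ l], which all have the
    same measure. *)
Lemma haar_odometer A : measurable A -> haar (odometer @^-1` A) = haar A.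
Proof.
move=> mA; rewrite -[LHS]/(distribution haar odometer A).
apply: measure_residue_unique => //=.
  by rewrite (le_lt_trans (probability_le1 _ _)) ?ltry.
move=> l p pl; rewrite /distribution /pushforward /=.
have -> : odometer @^-1` [set z | residue l z = p] =
    [set z | residue l z = ((p + (2 ^ l).-1) %% 2 ^ l)%N].
  have l0 : (0 < 2 ^ l)%N by rewrite expn_gt0.
  apply/seteqP; split=> z /=; rewrite residue_odometer.
    move=> <-; rewrite modnDml addSnnS prednK// modnDr modn_small//.
    exact: residue_lt.
  by move=> ->; rewrite -addn1 modnDml -addnA addn1 prednK// modnDr modn_small.
by rewrite !haar_residue// ltn_mod expn_gt0.
Qed.

Lemma measureI_eq_mod_null (nu : measure binary_sequence R)
    (A B C : set binary_sequence) :
    measurable A -> measurable B -> measurable C -> nu (A `+` B) = 0%E ->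
  nu (A `&` C) = nu (B `&` C).
Proof.
move=> mA mB mC AB0.
have le D E : measurable D -> measurable E -> nu (D `+` E) = 0%E ->
    (nu (D `&` C) <= nu (E `&` C))%E.
  move=> mD mE DE0; rewrite -[leRHS]adde0 -DE0.
  have mDE : measurable (D `+` E).
    by apply: measurableU; apply: measurableD.
  apply: (@le_trans _ _ (nu ((E `&` C) `|` (D `+` E)))).
    apply: le_measure; rewrite ?inE//.
    - exact: measurableI.
    - by apply: measurableU => //; exact: measurableI.
    - move=> z [Dz Cz]; have [Ez|nEz] := pselect (E z); first by left.
      by right; left.
  by apply: measureU2 => //; exact: measurableI.
apply/eqP; rewrite eq_le !le//.
by rewrite setYC.
Qed.

(** An invariant set [A] meets all residue classes modulo [2 ^ l] in the same
    measure, so it is independent of every residue class, hence of every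
    measurable set; being independent of itself, it has measure 0 or 1. *)
Lemma haar_odometer_ergodic A : measurable A ->
  haar (A `+` odometer @^-1` A) = 0%E -> haar A = 0%E \/ haar A = 1%E.
Proof.
move=> mA invA.
have mSA : measurable (odometer @^-1` A).
  by rewrite -[_ @^-1` _]setTI; exact: measurable_odometer.
have mres l p : measurable [set z | residue l z = p].
  exact: (measurable_residue_set l [set p]).
have const l p : (p < 2 ^ l)%N ->
    haar (A `&` [set z | residue l z = p]) =
    haar (A `&` [set z | residue l z = 0%N]).
  elim: p => [//|p IHp] pl; rewrite -IHp ?(ltnW pl)//.
  rewrite -haar_odometer; last exact: measurableI.
  rewrite preimage_setI.
  have -> : odometer @^-1` [set z | residue l z = p.+1] =
      [set z | residue l z = p].
    apply/seteqP; split=> z /=; rewrite residue_odometer.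
      have := residue_lt l z; rewrite leq_eqVlt => /orP[/eqP ->|zl].
        by rewrite modnn.
      by rewrite modn_small// => -[].
    by move=> ->; rewrite modn_small.
  by apply: esym; exact: measureI_eq_mod_null.
have fA : haar A \is a fin_num by rewrite fin_num_measure.
have A_ge0 : (0 <= fine (haar A))%R by rewrite fine_ge0.
have indep : mrestr haar mA A = mscale (NngNum A_ge0) haar A.
  apply: measure_residue_unique => //=.
    by rewrite /mrestr setTI (le_lt_trans (probability_le1 _ _)) ?ltry.
  move=> l p pl; rewrite /mrestr /mscale /= fineK// haar_residue//.
  rewrite setIC const//.
  have := measure_residue_sum (mrestr haar mA) l xpredT.
  have -> : [set z | xpredT (residue l z)] = setT by apply/seteqP; split.
  rewrite (eq_big_nat _ _ (F2 := fun=> haar (A `&` [set z | residue l z = 0%N]))).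
    rewrite big_const_seq count_predT size_iota subn0.
    have : haar (A `&` [set z | residue l z = 0%N]) \is a fin_num.
      by rewrite fin_num_measure//; exact: measurableI.
    case: (haar (_ `&` _)) => [c| |]// _.
    have -> k : iter k (+%E c%:E) 0%E = (k%:R * c)%:E.
      elim: k => [|k IHk]; rewrite ?mul0r// iterS IHk -EFinD.
      by rewrite mulrSr mulrDl mul1r addrC.
    rewrite /= /mrestr setTI => ->; rewrite -EFinM natrX mulrAC.
    by rewrite divff ?mul1r// expf_neq0.
  by move=> q ql; rewrite /= /mrestr setIC; exact: const.
move: indep; rewrite /mrestr /mscale /= setIid fineK//.
move: fA; case: (haar A) => [a| |]// _; rewrite -EFinM => -[] /eqP.
rewrite -subr_eq0 -{1}[a]mulr1 -mulrBr mulf_eq0 => /orP[/eqP->|]; first by left.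
by rewrite subr_eq0 => /eqP <-; right.
Qed.

Definition coded_law (f : {mfun binary_sequence >-> bool}) : process_law R :=
  distribution haar (coding f).

Lemma coded_lawE f A : coded_law f A = haar (coding f @^-1` A).
Proof. by []. Qed.

(** The shift on the codings is a factor of the odometer. *)
Lemma coded_law_stationary_ergodic f : stationary_ergodic R (coded_law f).
Proof.
have mF A : measurable A -> measurable (coding f @^-1` A).
  by move=> mA; rewrite -[_ @^-1` _]setTI; exact: measurable_coding.
have shiftE A : coding f @^-1` (left_shift @^-1` A) =
    odometer @^-1` (coding f @^-1` A).
  by apply/seteqP; split=> z; rewrite /preimage /= left_shift_coding.
split=> A mA; rewrite !coded_lawE; first by rewrite shiftE haar_odometer//; exact: mF.
move=> A0; apply: haar_odometer_ergodic; first exact: mF.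
by rewrite -shiftE; exact: A0.
Qed.

End haar.

(** * Runs of ones and the parity test *)

Definition has_run (S : nat) (w : seq bool) : bool :=
  [exists i : 'I_(size w).+1, [forall j : 'I_(2 ^ S).-1, nth false w (i + j)]].

Definition run_exponent (w : seq bool) : nat :=
  \max_(S < (size w).+1 | has_run S w) S.

Lemma has_runP S w : reflect
  (exists2 i, i <= size w & forall j, j < (2 ^ S).-1 -> nth false w (i + j))
  (has_run S w).
Proof.
apply: (iffP existsP) => [[i /forallP wi]|[i iw wi]].
  by exists i => [|j jS]; [rewrite -ltnS|exact: (wi (Ordinal jS))].
by exists (Ordinal (iw : i < (size w).+1)); apply/forallP => j; exact: wi.
Qed.

Lemma leq_has_run S S' w : S <= S' -> has_run S' w -> has_run S w.
Proof.
move=> SS' /has_runP[i iw wi]; apply/has_runP; exists i => // j jS; apply: wi.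
by apply: leq_trans jS _; rewrite -!subn1 leq_sub2r// leq_exp2l.
Qed.

Lemma has_run_leq_size S w : has_run S w -> S <= size w.
Proof.
move=> /has_runP[i iw wi].
have S1 : S <= (2 ^ S).-1 by rewrite -ltnS prednK ?expn_gt0// ltn_expl.
(* The last one of the run lies inside [w]. *)
case: S => [//|S] in wi S1 *.
have pS : (2 ^ S.+1).-1.-1 < (2 ^ S.+1).-1.
  by rewrite -{2}[(2 ^ _).-1]prednK//; apply: leq_trans S1.
have := wi _ pS.
case: (ltnP (i + (2 ^ S.+1).-1.-1) (size w)) => [|le]; last first.
  by rewrite nth_default.
by lia.
Qed.

Lemma run_exponentE S w : has_run S w -> ~~ has_run S.+1 w -> run_exponent w = S.
Proof.
move=> wS wS1; apply/eqP; rewrite eqn_leq; apply/andP; split.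
  apply/bigmax_leqP => S' wS'; rewrite leqNgt; apply: contra wS1 => SS'.
  exact: leq_has_run wS'.
have Sw : S < (size w).+1 by rewrite ltnS has_run_leq_size.
exact: (leq_bigmax_cond (Ordinal Sw)).
Qed.

Definition odd_run_exponent n (w : n.-tuple bool) : bool := odd (run_exponent w).

Lemma measurable_odd_run_exponent n :
  measurable_fun [set: n.-tuple bool] (@odd_run_exponent n).
Proof. by move=> _ B _; exact: measurable_tuple_set. Qed.

HB.instance Definition _ n := isMeasurableFun.Build _ _ _ _
  (@odd_run_exponent n) (@measurable_odd_run_exponent n).

Definition parity_test : test := fun n => @odd_run_exponent n.

Lemma nth_initial_block n x i :
  nth false (initial_block n x) i = (i < n) && x i.
Proof.
have [ltin|leni] := ltnP i n; last by rewrite nth_default// size_tuple.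
by rewrite -[i]/(val (Ordinal ltin)) -tnth_nth tnth_mktuple.
Qed.

(** * Hierarchical patterns of marks *)

(** Marks of stage [j] are runs of [2 ^ s - 1] ones that start at the multiples
    of [2 ^ l j]; the exponent [s] may depend on the position [z]. *)
Definition pattern (s : nat -> binary_sequence -> nat) (l : nat -> nat)
  (z : binary_sequence) : bool :=
  `[< exists j, residue (l j) z < (2 ^ s j z).-1 >].

(** A mark of exponent [s <= S] stops before the next position congruent to -1
    modulo [2 ^ s], in particular before any position congruent to -1 modulo
    [2 ^ S]. Such a position therefore carries a zero if it lies in no mark of
    exponent above [S]: overlapping marks never merge into a longer run. *)
Lemma pattern_run_break s l S z :
    (forall j, s j z <= l j) ->
    (forall j, residue (l j) z < (2 ^ s j z).-1 -> s j z <= S) ->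
  residue S z = (2 ^ S).-1 -> pattern s l z = false.
Proof.
move=> sl sS zS; apply/asboolPn => -[j zj]; have jS := sS j zj.
have := residue_mod z (sl j); rewrite -(residue_mod z jS) zS.
have -> : (2 ^ S).-1 %% 2 ^ s j z = (2 ^ s j z).-1.
  rewrite -(subnK jS) expnD; set a := 2 ^ (S - _); set b := 2 ^ s j z.
  have a0 : 0 < a by rewrite expn_gt0.
  have b0 : 0 < b by rewrite expn_gt0.
  rewrite (_ : (a * b).-1 = a.-1 * b + b.-1); last first.
    by case: a a0 b0 => // a _; rewrite mulSn; lia.
  by rewrite modnMDl modn_small// prednK.
by move=> E; have := leq_mod (residue (l j) z) (2 ^ s j z); rewrite E leqNgt zj.
Qed.

(** If all marks that meet a window have exponent at most [S], then
    [2 ^ S] consecutive positions always contain a zero, so one complete mark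
    of exponent [S] determines the run exponent. *)
Lemma run_exponent_coding s l S z n i j :
    (forall m y, s m y <= l m) ->
    (forall i m, i < n ->
      residue (l m) (iter i odometer z) < (2 ^ s m (iter i odometer z)).-1 ->
      s m (iter i odometer z) <= S) ->
    i + (2 ^ S).-1 <= n -> residue (l j) (iter i odometer z) = 0 ->
    (forall i', i' < (2 ^ S).-1 -> s j (iter (i + i') odometer z) = S) ->
  run_exponent (initial_block n (coding (pattern s l) z)) = S.
Proof.
move=> sl sS iSn zi0 si; apply: run_exponentE.
  apply/has_runP; exists i; first by rewrite size_tuple; lia.
  move=> i' i'S; rewrite nth_initial_block; apply/andP; split; first by lia.
  apply/asboolP; exists j; rewrite si// addnC iterD residue_iter_odometer zi0.
  have Sl : S <= l j by rewrite -(si _ i'S).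
  rewrite modn_small//; apply: leq_trans (i'S) _.
  by apply: leq_trans (leq_pred _) _; rewrite leq_exp2l.
apply/has_runP => -[i1 _ run].
(* [i1 + i2] is the first position from [i1] on that is congruent to -1. *)
pose y := iter i1 odometer z; pose i2 := (2 ^ S).-1 - residue S y.
have yS := residue_lt S y.
have i2S : i2 < (2 ^ S.+1).-1 by rewrite /i2 expnS; lia.
have := run _ i2S; rewrite nth_initial_block => /andP[i12n].
rewrite /coding (@pattern_run_break _ _ S)//.
  by move=> m; exact: sS.
rewrite addnC iterD residue_shift; last by rewrite -/y /i2; lia.
by rewrite -/y /i2; lia.
Qed.

Lemma measurable_pattern s l :
    (forall j y z, residue (l j.+1) y = residue (l j.+1) z -> s j y = s j z) ->
    (forall j, l j <= l j.+1) ->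
  measurable_fun [set: binary_sequence] (pattern s l).
Proof.
move=> sE lS; apply: (measurable_fun_bool true); rewrite setTI.
have -> : pattern s l @^-1` [set true] =
    \bigcup_j [set z | residue (l j) z < (2 ^ s j z).-1].
  apply/seteqP; split=> z /=; first by move/asboolP => -[j zj]; exists j.
  by move=> [j _ zj]; apply/asboolP; exists j.
apply: bigcupT_measurable => j; apply: (@measurable_finitary (l j.+1)) => y z.
by move=> /eq_residueP yz /=; rewrite (sE j y z)// (eq_residue_le (lS j) yz).
Qed.

(** The density [2 ^- rarity j] of the odd part of stage [j] has to tend to 0,
    yet so slowly that the densities have a divergent sum. *)
Definition rarity (j : nat) : nat := (trunc_log 2 j.+2).-1.

Lemma rarity_le j : rarity j <= j.
Proof.
rewrite /rarity; have := @trunc_logP 2 j.+2 isT isT.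
have := @ltn_expl 2 (trunc_log 2 j.+2) isT; lia.
Qed.

Lemma rarity_homo j k : j <= k -> rarity j <= rarity k.
Proof. by move=> jk; rewrite /rarity -!subn1 leq_sub2r// leq_trunc_log. Qed.

Lemma rarity_pow k : 2 ^ (rarity k).+1 <= k.+2.
Proof.
rewrite /rarity prednK; first exact: trunc_logP.
by rewrite trunc_log_gt0.
Qed.

Lemma rarity_ge m k : 2 ^ m.+1 <= k -> m <= rarity k.
Proof.
move=> mk; rewrite /rarity -ltnS prednK ?trunc_log_gt0//.
by apply: trunc_log_max => //; lia.
Qed.

Definition odd_part (l : nat -> nat) (j : nat) (z : binary_sequence) : bool :=
  residue (l j.+1) z < 2 ^ (l j.+1 - rarity j).

(** With these values the parity of the largest visible exponent tells whether
    the last visible stage is seen from its odd part. *)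
Definition mark_exponent (l : nat -> nat) (j : nat) (z : binary_sequence) : nat :=
  if odd_part l j z then (2 * j).+1 else (2 * j).+2.

(** The exponents of the periodic process that goes on for ever as the odd part
    of stage [k] begins; exponent 0 means that there is no mark at all. *)
Definition cut_exponent (l : nat -> nat) (k j : nat) (z : binary_sequence) : nat :=
  if j < k then mark_exponent l j z else if j == k then (2 * k).+1 else 0.

Definition full_pattern l := pattern (mark_exponent l) l.

Definition cut_pattern l k := pattern (cut_exponent l k) l.

Lemma mark_exponent_le l j z : mark_exponent l j z <= (2 * j).+2.
Proof. by rewrite /mark_exponent; case: ifP. Qed.

Lemma eq_cut_pattern l l' k : (forall j, j <= k -> l j = l' j) ->
  cut_pattern l k = cut_pattern l' k.
Proof.
move=> ll'; apply/funext => z; congr asbool; apply: eq_exists => j.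
rewrite /cut_exponent; case: (ltngtP j k) => jk //; rewrite ?ltn0//.
- by rewrite /mark_exponent /odd_part !ll'// ltnW.
- by rewrite jk ll'.
Qed.

(** The growth makes marks shorter than the distance between two marks of their
    own stage, and the probabilities of meeting the later stages decrease
    geometrically. *)
Definition spaced_upto (k : nat) (l : nat -> nat) : Prop :=
  2 <= l 0 /\ forall j, j < k -> l j + 4 * j + 10 <= l j.+1.

Definition spaced (l : nat -> nat) : Prop := forall k, spaced_upto k l.

Lemma spaced_uptoW k j l : j <= k -> spaced_upto k l -> spaced_upto j l.
Proof. by move=> jk [l0 lS]; split=> // i ij; apply: lS; lia. Qed.

Lemma spaced_upto_ge k l : spaced_upto k l -> 4 * k <= l k /\ (2 * k).+2 <= l k.
Proof.
elim: k => [[]//|k IHk] sp; have := IHk (spaced_uptoW (leqnSn k) sp).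
by have := sp.2 k (ltnSn k); lia.
Qed.

Lemma leq_spaced_upto k l i : spaced_upto k l -> i <= k -> l i <= l k.
Proof.
elim: k => [|k IHk] sp; first by rewrite leqn0 => /eqP ->.
rewrite leq_eqVlt => /orP[/eqP -> //|]; rewrite ltnS => ik.
have := IHk (spaced_uptoW (leqnSn k) sp) ik; have := sp.2 k (ltnSn k); lia.
Qed.

Lemma spaced_ge l j : spaced l -> (2 * j).+2 <= l j.
Proof. by move=> sp; have [] := spaced_upto_ge (sp j). Qed.

Lemma spacedS l j : spaced l -> l j + 4 * j + 10 <= l j.+1.
Proof. by move=> sp; exact: (sp j.+1).2. Qed.

Lemma spaced_margin l j : spaced l -> 0 < j ->
  l j.-1 + 4 * j + 6 <= l j /\ 3 * j + 4 <= l j.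
Proof. by case: j => // j sp _ /=; have := spacedS j sp; lia. Qed.

Lemma spaced_locate l K0 n : spaced l -> 2 ^ (l K0).+1 <= n ->
  exists2 K, K0 <= K & 2 ^ (l K).+1 <= n < 2 ^ (l K.+1).+1.
Proof.
move=> sp nK0; suff H d : n < 2 ^ (l (K0 + d)).+1 ->
    exists2 K, K0 <= K & 2 ^ (l K).+1 <= n < 2 ^ (l K.+1).+1.
  apply: (H n); apply: (leq_trans (ltn_expl n (ltnSn 1))); rewrite leq_exp2l//.
  by have := spaced_ge (K0 + n) sp; lia.
elim: d => [|d IHd]; first by rewrite addn0 ltnNge nK0.
have [lt _|ge lt] := ltnP n (2 ^ (l (K0 + d)).+1); first exact: IHd.
by exists (K0 + d); rewrite ?leq_addr// ge -addnS.
Qed.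

Lemma measurable_full_pattern l : spaced l ->
  measurable_fun [set: binary_sequence] (full_pattern l).
Proof.
move=> sp; apply: measurable_pattern => j; last by have := spacedS j sp; lia.
by move=> y z; rewrite /mark_exponent /odd_part => ->.
Qed.

(** The cut pattern is periodic with period [2 ^ l k]. *)
Lemma eq_coding_cut_pattern l k y z : spaced_upto k l ->
  residue (l k) y = residue (l k) z ->
  coding (cut_pattern l k) y = coding (cut_pattern l k) z.
Proof.
move=> sp yz; apply/funext => i; rewrite /coding.
have {yz} : residue (l k) (iter i odometer y) = residue (l k) (iter i odometer z).
  by rewrite !residue_iter_odometer yz.
move: (iter i _ y) (iter i _ z) => {}y {}z yz.
have yzj j : j <= k -> residue (l j) y = residue (l j) z.
  by move=> jk; apply: eq_residue_le yz; exact: leq_spaced_upto jk.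
congr asbool; apply: eq_exists => j; rewrite /cut_exponent.
have [jk|kj|->] := ltngtP j k; rewrite ?ltn0 ?yz//.
by rewrite /mark_exponent /odd_part !yzj// ltnW.
Qed.

Lemma measurable_cut_pattern l k : spaced_upto k l ->
  measurable_fun [set: binary_sequence] (cut_pattern l k).
Proof.
move=> sp; apply: (measurable_fun_bool true); rewrite setTI.
apply: (@measurable_finitary (l k)) => y z /eq_residueP yz /=.
have := congr1 (fun x => x 0%N) (eq_coding_cut_pattern sp yz).
by rewrite /coding /= => ->.
Qed.

(** * Windows of the patterns *)

(** A window longer than two periods contains a complete mark of stage [k]. *)
Lemma run_exponent_cut_pattern l k z n : spaced_upto k l ->
  2 ^ (l k).+1 <= n ->
  run_exponent (initial_block n (coding (cut_pattern l k) z)) = (2 * k).+1.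
Proof.
move=> sp len; have zl := residue_lt (l k) z.
have lk j : j <= k -> (2 * j).+2 <= l j.
  by move=> jk; have [] := spaced_upto_ge (spaced_uptoW jk sp).
apply: (@run_exponent_coding _ _ _ _ _ (2 ^ l k - residue (l k) z) k).
- move=> j y; rewrite /cut_exponent.
  case: ltngtP => // [jk|->]; last exact: ltnW (lk _ _).
  by apply: leq_trans (mark_exponent_le _ _ _) (lk _ (ltnW jk)).
- move=> i j _ _; rewrite /cut_exponent; case: ltngtP => // jk.
  by apply: leq_trans (mark_exponent_le _ _ _) _; lia.
- have : 2 ^ (2 * k).+1 <= 2 ^ l k by rewrite leq_exp2l// ltnW// lk.
  by move: len; rewrite expnS; lia.
- by rewrite residue_iter_odometer subnKC ?modnn// ltnW.
- by move=> i _; rewrite /cut_exponent ltnn eqxx.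
Qed.

(** No mark of a stage above [K] begins or goes on in the window of length [n]
    that starts at [z]. In such a window the residues of these stages increase
    without being reduced. *)
Definition clear_above (l : nat -> nat) (K n : nat) (z : binary_sequence) :
    Prop :=
  forall j, K < j ->
    2 ^ (2 * j).+2 <= residue (l j) z /\ residue (l j) z + n <= 2 ^ l j.

Lemma clear_above_shift l K n z i j : clear_above l K n z -> i < n -> K < j ->
  residue (l j) (iter i odometer z) = residue (l j) z + i.
Proof.
by move=> clz iltn Kj; rewrite residue_shift//; have [_] := clz _ Kj; lia.
Qed.

Lemma clear_above_mark l K n z i j s : clear_above l K n z -> i < n -> K < j ->
  s <= (2 * j).+2 -> residue (l j) (iter i odometer z) < (2 ^ s).-1 = false.
Proof.
move=> clz iltn Kj sj; rewrite (clear_above_shift clz)//.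
apply/negbTE; rewrite -leqNgt.
have [+ _] := clz _ Kj; have : 2 ^ s <= 2 ^ (2 * j).+2 by rewrite leq_exp2l.
lia.
Qed.

Lemma run_exponent_full_pattern l K n z i : spaced l -> clear_above l K n z ->
    ~~ odd_part l K z -> i + 2 ^ (2 * K).+2 <= n ->
    residue (l K) (iter i odometer z) = 0 ->
  run_exponent (initial_block n (coding (full_pattern l) z)) = (2 * K).+2.
Proof.
move=> sp clz zK iKn zi0; have K2 : 0 < 2 ^ (2 * K).+2 by rewrite expn_gt0.
apply: (@run_exponent_coding _ _ _ _ _ i K) => //.
- by move=> j y; apply: leq_trans (mark_exponent_le _ _ _) (spaced_ge _ sp).
- move=> i' j i'n; have [jK|Kj] := leqP j K.
    by move=> _; apply: leq_trans (mark_exponent_le _ _ _) _; lia.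
  by rewrite (clear_above_mark clz)// mark_exponent_le.
- lia.
- move=> i' i'K; rewrite /mark_exponent /odd_part.
  rewrite (clear_above_shift clz)//; last by lia.
  by rewrite ifN//; move: zK; rewrite /odd_part -!leqNgt; lia.
Qed.

(** Inside the odd part of stage [k], away from later stages, the full pattern
    cannot be told from the cut one. *)
Lemma initial_block_full_pattern l k n z : clear_above l k n z ->
    residue (l k.+1) z + n <= 2 ^ (l k.+1 - rarity k) ->
  initial_block n (coding (full_pattern l) z) =
  initial_block n (coding (cut_pattern l k) z).
Proof.
move=> clz zk; apply: eq_from_tnth => i; rewrite !tnth_mktuple.
have ilt := ltn_ord i.
congr asbool; apply: eq_exists => j; rewrite /cut_exponent.
have [jk|kj|->] := ltngtP j k => //.
  by rewrite (clear_above_mark clz)// mark_exponent_le.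
rewrite /mark_exponent ifT// /odd_part (clear_above_shift clz)//.
by lia.
Qed.

(** The failure of the condition of [clear_above] at stage [j], for a window
    length that depends on the stage. *)
Definition touched (l nn : nat -> nat) (j : nat) : set binary_sequence :=
  [set z | residue (l j) z < 2 ^ (2 * j).+2 \/
           2 ^ l j < residue (l j) z + nn j].

Lemma measurable_touched l nn j : measurable (touched l nn j).
Proof.
exact: (measurable_residue_set (l j)
  [set p | p < 2 ^ (2 * j).+2 \/ 2 ^ l j < p + nn j]).
Qed.

(** Let [K] be the stage whose period is of the order of the window length. If
    the window meets no point of stage [K.+1], the largest visible exponent is
    that of stage [K]; if it contains a complete mark of stage [K.+1], it is
    that of stage [K.+1]. Both are even off the odd parts. What remains is a
    window that ends inside a mark of stage [K.+1]. *)
Lemma parity_test_full_pattern l K n z : spaced l ->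
    2 ^ (l K).+1 <= n < 2 ^ (l K.+1).+1 ->
    ~~ odd_part l K z -> ~~ odd_part l K.+1 z ->
    (forall j, K.+1 < j -> ~ touched l (fun=> n) j z) ->
    ~~ (2 ^ l K.+1 < residue (l K.+1) z + n < 2 ^ l K.+1 + 2 ^ (2 * K.+1).+2) ->
  parity_test n (initial_block n (coding (full_pattern l) z)) = false.
Proof.
move=> sp /andP[nK nK1] zK zK1 above partial.
have clear1 : clear_above l K.+1 n z.
  by move=> j Kj; have := above j Kj; rewrite /touched /=; lia.
have sK := spacedS K sp.
suff [S] : exists S,
    run_exponent (initial_block n (coding (full_pattern l) z)) = (2 * S).+2.
  rewrite /parity_test /= /odd_run_exponent => ->.
  by rewrite /= negbK mul2n odd_double.
have zlt := residue_lt (l K.+1) z.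
have [le|gt] := leqP (residue (l K.+1) z + n) (2 ^ l K.+1).
  exists K.
  apply: (@run_exponent_full_pattern _ _ _ _ (2 ^ l K - residue (l K) z)) => //.
  - move=> j; rewrite leq_eqVlt => /orP[/eqP <-|]; last exact: clear1.
    split=> //; move: zK; rewrite /odd_part -leqNgt; apply: leq_trans.
    by rewrite leq_exp2l//; have := rarity_le K; lia.
  - have : 2 ^ (2 * K).+2 <= 2 ^ l K by rewrite leq_exp2l// spaced_ge.
    by move: nK; rewrite expnS; lia.
  - by rewrite residue_iter_odometer subnKC ?modnn// ltnW// residue_lt.
exists K.+1.
apply: (@run_exponent_full_pattern _ _ _ _
  (2 ^ l K.+1 - residue (l K.+1) z)) => //.
- by move: partial; rewrite gt /=; lia.
- by rewrite residue_iter_odometer subnKC ?modnn// ltnW.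
Qed.

(** * The parity test errs rarely on the full pattern *)

Section parity_error.
Variable R : realType.
Local Notation mu := (haar R).

Lemma count_interval a b N : count (fun p => (a <= p < b)%N) (iota 0 N) <= b - a.
Proof.
rewrite -size_filter -(size_iota a (b - a)).
apply: uniq_leq_size; first by rewrite filter_uniq ?iota_uniq.
by move=> p; rewrite mem_filter !mem_iota => /andP[+ _]; lia.
Qed.

Lemma haar_interval l a b m c : (b <= a + 2 ^ m)%N -> (m + c <= l)%N ->
  (mu [set z | (a <= residue l z < b)%N] <= (2 ^- c)%:E)%E.
Proof.
move=> bam mcl; rewrite (haar_residue_set R l (fun p => (a <= p < b)%N)) lee_fin.
rewrite ler_pdivrMr ?exprn_gt0// (@le_trans _ _ (2 ^ m)%:R%R)//.
  by rewrite ler_nat (leq_trans (count_interval _ _ _))// leq_subLR.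
rewrite natrX -(subnKC mcl) !exprD [(2 ^+ m * _)%R]mulrC -!mulrA mulKf ?expf_neq0//.
rewrite ler_peMr ?exprn_ge0//.
by rewrite exprn_ege1 ?ler1n.
Qed.

Lemma haar_odd_part l K : spaced l ->
  (mu [set z | odd_part l K z] <= (2 ^- rarity K)%:E)%E.
Proof.
move=> sp; rewrite (_ : [set _ | _] =
    [set z | (0 <= residue (l K.+1) z < 2 ^ (l K.+1 - rarity K))%N]).
  apply: (@haar_interval _ _ _ (l K.+1 - rarity K)); first by rewrite add0n.
  by have := spacedS K sp; have := rarity_le K; lia.
by apply/seteqP; split.
Qed.

Lemma haar_touched l nn j : (3 * j + 4 <= l j)%N -> (nn j <= 2 ^ (l j - j.+2))%N ->
  (mu (touched l nn j) <= (2 ^- j.+1)%:E)%E.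
Proof.
move=> lj nj.
have -> : touched l nn j = [set z | (0 <= residue (l j) z < 2 ^ (2 * j).+2)%N] `|`
    [set z | ((2 ^ l j - nn j).+1 <= residue (l j) z < 2 ^ l j)%N].
  have : (2 ^ (l j - j.+2) <= 2 ^ l j)%N by rewrite leq_exp2l// leq_subr.
  move=> ?; apply/seteqP; split=> z /=; have := residue_lt (l j) z => zl [?|?];
    by [left; lia|right; lia].
set A := [set z | _]; set B := [set z | _].
apply: (@le_trans _ _ (mu A + mu B)%E).
  apply: measureU2.
    exact: (measurable_residue_set (l j) [set p | (0 <= p < 2 ^ (2 * j).+2)%N]).
  exact: (measurable_residue_set (l j)
    [set p | ((2 ^ l j - nn j).+1 <= p < 2 ^ l j)%N]).
have -> : ((2 ^- j.+1)%:E = (2 ^- j.+2)%:E + (2 ^- j.+2)%:E :> \bar R)%E.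
  by rewrite -EFinD [in RHS]exprS invfM; congr (_%:E); lra.
apply: leeD.
  by apply: (@haar_interval _ _ _ (2 * j).+2); lia.
apply: (@haar_interval _ _ _ (l j - j.+2)); last by lia.
have : (2 ^ (l j - j.+2) <= 2 ^ l j)%N by rewrite leq_exp2l// leq_subr.
lia.
Qed.

(** The bounds [2 ^- j.+1] of the later stages sum to [2 ^- K.+1]. *)
Lemma haar_touched_tail l nn K :
    (forall j, K < j -> 3 * j + 4 <= l j /\ nn j <= 2 ^ (l j - j.+2)) ->
  (mu (\bigcup_(j in [set j | (K < j)%N]) touched l nn j) <= (2 ^- K.+1)%:E)%E.
Proof.
move=> H; have -> : \bigcup_(j in [set j | (K < j)%N]) touched l nn j =
    \bigcup_i touched l nn (K.+1 + i)%N.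
  apply/seteqP; split=> z [j].
    by move=> /= Kj zj; exists (j - K.+1)%N; rewrite // subnKC.
  by move=> _ zj; exists (K.+1 + j)%N => //=; lia.
apply: le_trans.
  apply: measure_sigma_subadditive => [i||]; last exact: subset_refl.
    exact: measurable_touched.
  by apply: bigcupT_measurable => i; exact: measurable_touched.
have e0 : (0 <= 2 ^- K.+1 :> R)%R by rewrite invr_ge0 exprn_ge0.
have := @epsilon_trick R (fun=> 0%E) (2 ^- K.+1)%R xpredT (fun=> lexx _) e0.
rewrite [X in (_ <= X + _)%E -> _]eseries0// add0e.
apply: le_trans; apply: lee_nneseries => [i *|i _]; first exact: measure_ge0.
rewrite add0e; have [lj nj] := H (K.+1 + i)%N ltac:(lia).
apply: le_trans (haar_touched lj nj) _.
by rewrite lee_fin natrX -invfM -exprD -addnS.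
Qed.

Lemma measurable_parity_error l n : spaced l -> measurable
  [set z | parity_test n (initial_block n (coding (full_pattern l) z)) <> false].
Proof.
move=> sp; have [f fE] := mfun_of_measurable (measurable_full_pattern sp).
rewrite -fE -[X in measurable X]setTI.
exact: (measurable_coding f measurableT
  (measurable_cylinder [set w | parity_test n w <> false])).
Qed.

Lemma haar_parity_error l K n : spaced l ->
    2 ^ (l K).+1 <= n < 2 ^ (l K.+1).+1 ->
  (mu [set z | parity_test n (initial_block n (coding (full_pattern l) z)) <> false]
   <= (2 ^- rarity K + 2 ^- rarity K.+1 + 2 ^- K.+2 + 2 ^- K)%:E)%E.
Proof.
move=> sp nK; have sK := spacedS K sp.
have mres l' (B : set nat) := measurable_residue_set l' B.
set E := [set z | _].
pose lo := 2 ^ l K.+1 + 1 - n.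
pose hi := 2 ^ l K.+1 + 2 ^ (2 * K.+1).+2 - n.
(* The windows that end inside a mark of stage [K.+1]. *)
pose P := [set z | lo <= residue (l K.+1) z < hi].
pose T := \bigcup_(j in [set j | (K.+1 < j)%N]) touched l (fun=> n) j.
pose O k := [set z | odd_part l k z].
have mO k : measurable (O k).
  exact: (mres (l k.+1) [set p | p < 2 ^ (l k.+1 - rarity k)]).
have mP : measurable P by exact: (mres (l K.+1) [set p | lo <= p < hi]).
have mT : measurable T by apply: bigcup_measurable => j _; exact: measurable_touched.
have EU : E `<=` O K `|` O K.+1 `|` T `|` P.
  move=> z; rewrite /E /= => bad; apply: contrapT => good; apply: bad.
  apply: (@parity_test_full_pattern _ K) => //.
  - by apply/negP => zO; apply: good; left; left; left.
  - by apply/negP => zO; apply: good; left; left; right.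
  - by move=> j Kj zj; apply: good; left; right; exists j.
  - by apply/negP => zP; apply: good; right; rewrite /P /lo /hi /=; lia.
have mE : measurable E by exact: measurable_parity_error.
have mOO : measurable (O K `|` O K.+1) by exact: measurableU.
have mOT : measurable (O K `|` O K.+1 `|` T) by exact: measurableU.
apply: (@le_trans _ _ (mu (O K `|` O K.+1 `|` T `|` P))).
  by apply: le_measure; rewrite ?inE//; exact: measurableU.
apply: (@le_trans _ _ (mu (O K `|` O K.+1 `|` T) + mu P)%E); first exact: measureU2.
rewrite EFinD; apply: leeD.
  apply: (@le_trans _ _ (mu (O K `|` O K.+1) + mu T)%E); first exact: measureU2.
  rewrite EFinD; apply: leeD.
    apply: (@le_trans _ _ (mu (O K) + mu (O K.+1))%E); first exact: measureU2.
    by rewrite EFinD; apply: leeD; exact: haar_odd_part.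
  apply: haar_touched_tail => j Kj.
  have [lj1 lj2] := spaced_margin sp (ltn_trans (ltn0Sn _) Kj).
  split=> //; case/andP: nK => _ /ltnW/leq_trans; apply; rewrite leq_exp2l//.
  have : l K.+1 <= l j.-1 by apply: (leq_spaced_upto (sp _)); lia.
  lia.
apply: (@haar_interval _ _ _ (2 * K.+1).+2); first by rewrite /lo /hi; lia.
have [? ?] := spaced_upto_ge (sp K.+1); lia.
Qed.

(** The four error terms are at most [2 ^- m] as soon as the stage that is
    comparable with the window length is at least [2 ^ m.+1]. *)
Lemma parity_error_cvg l : spaced l ->
  mu [set z | parity_test n (initial_block n (coding (full_pattern l) z)) <> false]
    @[n --> \oo] --> 0%E.
Proof.
move=> sp; have mE n := measurable_parity_error n sp.
apply/fine_cvgP; split; first by near=> n; rewrite fin_num_measure.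
apply/cvgrPdist_le => /= e e0.
pose m := Num.bound (4 / e)%R.
have me : (4 * 2 ^- m <= e)%R.
  rewrite ler_pdivrMr ?exprn_gt0// mulrC -ler_pdivrMr//.
  have /archi_boundP/ltW/le_trans : (0 <= 4 / e)%R by rewrite divr_ge0// ltW.
  by apply; rewrite -natrX ler_nat ltnW// ltn_expl.
near=> n.
have [K mK nK] : exists2 K, 2 ^ m.+1 <= K & 2 ^ (l K).+1 <= n < 2 ^ (l K.+1).+1.
  by apply: spaced_locate => //; near: n; exact: nbhs_infty_ge.
rewrite sub0r normrN ger0_norm ?fine_ge0//.
rewrite -lee_fin fineK; last by rewrite fin_num_measure//; exact: mE.
apply: le_trans (haar_parity_error sp nK) _; rewrite lee_fin; apply: le_trans me.
have pow_le i : (m <= i)%N -> (2 ^- i <= 2 ^- m :> R)%R.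
  by move=> mi; rewrite lef_pV2 ?posrE ?exprn_gt0// ler_weXn2l// ler1n.
have mr := rarity_ge mK; have rK := rarity_le K.
have rK1 := rarity_homo (leqnSn K).
have := pow_le _ mr; have := pow_le (rarity K.+1) ltac:(lia).
have := pow_le K ltac:(lia); have := pow_le K.+2 ltac:(lia); lra.
Unshelve. all: end_near.
Qed.

End parity_error.

(** * Almost every point visits infinitely many odd parts *)

(** A window that starts in the first half of the odd part and is no longer than
    half of it ends before the odd part does. *)
Definition odd_half (l : nat -> nat) (k : nat) (z : binary_sequence) : bool :=
  residue (l k.+1) z < 2 ^ (l k.+1 - (rarity k).+1).

Definition missed (l : nat -> nat) (K M : nat) : set binary_sequence :=
  [set z | forall k, K <= k < M -> ~~ odd_half l k z].

Lemma missedE l K M : spaced l -> missed l K M =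
  [set z | `[< forall k, K <= k < M ->
      2 ^ (l k.+1 - (rarity k).+1) <= residue (l M) z %% 2 ^ l k.+1 >] ].
Proof.
move=> sp; apply/seteqP; split=> z /=.
  move=> zH; apply/asboolP => k kM; have := zH k kM; rewrite /odd_half -leqNgt.
  by rewrite residue_mod//; apply: (leq_spaced_upto (sp M)); case/andP: kM.
move=> /asboolP zH k kM; have := zH k kM; rewrite /odd_half -leqNgt.
by rewrite residue_mod//; apply: (leq_spaced_upto (sp M)); case/andP: kM.
Qed.

Lemma measurable_missed l K M : spaced l -> measurable (missed l K M).
Proof.
by move=> sp; rewrite missedE//; exact: (measurable_residue_set (l M)
  [set p | `[< forall k, K <= k < M ->
    2 ^ (l k.+1 - (rarity k).+1) <= p %% 2 ^ l k.+1 >] ]).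
Qed.

Lemma measurable_missed_forever l K : spaced l ->
  measurable [set z | forall k, K <= k -> ~~ odd_half l k z].
Proof.
move=> sp; rewrite (_ : [set _ | _] = \bigcap_M missed l K M).
  by apply: bigcapT_measurable => M; exact: measurable_missed.
apply/seteqP; split=> z zZ; first by move=> M _ k /andP[Kk _]; exact: zZ.
by move=> k Kk; apply: (zZ k.+1 Logic.I); rewrite Kk /=.
Qed.

Section odd_halves.
Variable R : realType.
Local Notation mu := (haar R).

(** The condition [residue l' z < 2 ^ m] says that the digits from [m] to
    [l' - 1] vanish, so it is independent of the digits below [l]. *)
Lemma haar_indep l m l' (B : pred nat) : (l <= m)%N -> (m <= l')%N ->
  (mu ([set z | B (residue l z)] `&` [set z | (residue l' z < 2 ^ m)%N]) =
   mu [set z | B (residue l z)] * (2 ^- (l' - m))%:E)%E.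
Proof.
move=> lm ml'.
have -> : [set z | B (residue l z)] `&` [set z | (residue l' z < 2 ^ m)%N] =
    [set z | [pred p | B (p %% 2 ^ l)%N && (p < 2 ^ m)%N] (residue l' z)].
  apply/seteqP; split=> z /=; rewrite (residue_mod _ (leq_trans lm ml')).
    by case=> -> ->.
  by case/andP.
have -> : [set z | B (residue l z)] = [set z | [pred p | B (p %% 2 ^ l)%N] (residue m z)].
  by apply/seteqP; split=> z /=; rewrite (residue_mod _ lm).
rewrite !haar_residue_set -EFinM; congr (_%:E).
have -> : count [pred p | B (p %% 2 ^ l)%N && (p < 2 ^ m)%N] (iota 0 (2 ^ l')) =
    count [pred p | B (p %% 2 ^ l)%N] (iota 0 (2 ^ m)).
  rewrite -(subnKC (_ : 2 ^ m <= 2 ^ l')%N) ?leq_exp2l// iotaD count_cat add0n.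
  rewrite [X in (_ + X)%N](_ : _ = 0%N) ?addn0; last first.
    apply/eqP; rewrite -leqn0 leqNgt -has_count; apply/hasPn => p.
    by rewrite mem_iota /= => /andP[mp _]; rewrite ltnNge mp andbF.
  by apply: eq_in_count => p; rewrite mem_iota /= => ->; rewrite andbT.
by rewrite -[in LHS](subnK ml') exprD invfM [(_^-1 * _)%R]mulrC mulrA.
Qed.

(** The odd half of stage [M] is independent of the earlier ones and has
    probability at least [1 / (M + 2)], so that the bounds telescope:
    [(K + 1) / (M + 1) * (1 - 1 / (M + 2)) = (K + 1) / (M + 2)]. *)
Lemma haar_missed l K M : spaced l -> (K <= M)%N ->
  (mu (missed l K M) <= (K.+1%:R / M.+1%:R)%:E)%E.
Proof.
move=> sp; elim: M => [|M IHM] KM.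
  move: KM; rewrite leqn0 => /eqP ->; rewrite divff//.
  exact: probability_le1 (measurable_missed _ _ sp).
move: KM; rewrite leq_eqVlt => /orP[/eqP ->|].
  by rewrite divff//; exact: probability_le1 (measurable_missed _ _ sp).
rewrite ltnS => KM; have {}IHM := IHM KM.
have mM := measurable_missed K M sp.
have sM := spacedS M sp; have rM := rarity_le M.
pose H := [set z | odd_half l M z].
have mH : measurable H.
  exact: (measurable_residue_set (l M.+1)
    [set p | p < 2 ^ (l M.+1 - (rarity M).+1)]).
have indep : (mu (missed l K M `&` H) =
    mu (missed l K M) * (2 ^- (rarity M).+1)%:E)%E.
  rewrite missedE//.
  have -> : H =
    [set z | (residue (l M.+1) z < 2 ^ (l M.+1 - (rarity M).+1))%N] by [].
  rewrite (@haar_indep (l M) _ _ (fun p => `[< forall k, (K <= k < M)%N ->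
      (2 ^ (l k.+1 - (rarity k).+1) <= p %% 2 ^ l k.+1)%N >])); [|lia|lia].
  by rewrite subKn//; lia.
have sub : missed l K M.+1 `<=` missed l K M `\` H.
  move=> z zK; split; first by move=> k kM; apply: zK; lia.
  by apply/negP; apply: zK; lia.
apply: (@le_trans _ _ (mu (missed l K M `\` H))).
  by apply: le_measure; rewrite ?inE//; [exact: measurable_missed|exact: measurableD].
have fM : mu (missed l K M) \is a fin_num by exact: fin_num_measure.
have -> : (mu (missed l K M `\` H) =
    mu (missed l K M) - mu (missed l K M `&` H))%E.
  by apply: measureD => //; rewrite ltey_eq fM.
have pos : (0 <= mu (missed l K M))%E by exact: measure_ge0.
rewrite indep; move: IHM pos; case: (mu (missed l K M)) fM => [a| |]// _.
rewrite -EFinM -EFinB !lee_fin => aK a_ge0.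
have qM : (1 <= 2 ^- (rarity M).+1 * (M.+1%:R + 1) :> R)%R.
  rewrite mulrC ler_pdivlMr ?exprn_gt0// mul1r natr1 -natrX ler_nat.
  exact: rarity_pow.
have M0 : (0 < M.+1%:R :> R)%R by rewrite ltr0n.
have M1 : (0 < M.+1%:R + 1 :> R)%R by rewrite addr_gt0.
move: aK; rewrite -[(M.+2%:R)%R]natr1 !ler_pdivlMr//.
move: (M.+1%:R)%R (K.+1%:R)%R M0 qM => x y x0 qx ax.
have : (0 <= a * (2 ^- (rarity M).+1 * (x + 1) - 1))%R.
  by rewrite mulr_ge0// subr_ge0.
move: (2 ^- _)%R => q; nra.
Qed.

(** This is the second Borel-Cantelli lemma for the odd halves. *)
Lemma haar_missed_forever l K : spaced l ->
  mu [set z | forall k, K <= k -> ~~ odd_half l k z] = 0%E.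
Proof.
move=> sp; have := measurable_missed_forever K sp; set Z := [set z | _] => mZ.
have Zle M : (K <= M)%N -> (mu Z <= (K.+1%:R / M.+1%:R)%:E)%E.
  move=> KM; apply: le_trans (haar_missed sp KM); apply: le_measure; rewrite ?inE//.
    exact: measurable_missed.
  by move=> z zZ k /andP[Kk _]; exact: zZ.
have pos : (0 <= mu Z)%E by exact: measure_ge0.
move: pos; have : mu Z \is a fin_num by exact: fin_num_measure.
case: (mu Z) Zle => [a| |]// Zle _; rewrite lee_fin le_eqVlt => /orP[/eqP <- //|a0].
pose M := maxn K (Num.bound (K.+1%:R / a)%R).
have := Zle M (leq_maxl _ _); rewrite lee_fin ler_pdivlMr ?ltr0n// => aM.
have /archi_boundP : (0 <= K.+1%:R / a)%R by rewrite divr_ge0// ltW.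
rewrite ltr_pdivrMr// => lt.
have : ((Num.bound (K.+1%:R / a))%:R <= M.+1%:R :> R)%R.
  by rewrite ler_nat ltnW// ltnS leq_maxr.
rewrite -(ler_pM2l a0) => le; exfalso.
by move: (le_trans le aM); rewrite mulrC leNgt lt.
Qed.

End odd_halves.

(** * Diagonalization against a strong test *)

Lemma exists_history_sequence (G : seq nat -> nat) :
  exists l : nat -> nat, forall k, l k = G (mkseq l k).
Proof.
pose hist k := iter k (fun h => rcons h (G h)) [::].
exists (fun k => G (hist k)) => k; congr G.
by elim: k => [//|k IHk]; rewrite mkseqS -IHk.
Qed.

(** The hypotheses are made as large as the parity test allows, so that its weak
    consistency holds by definition and the impossibility of a strong test can
    use every process on which the parity test converges in probability. *)
Definition parity_class (R : realType) (i : bool) : set (process_law R) :=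
  [set rho | stationary_ergodic R rho /\
    rho [set x | parity_test n (initial_block n x) <> i] @[n --> \oo] --> 0%E].

Arguments parity_class : clear implicits.

Section diagonal.
Variable R : realType.
Local Notation mu := (haar R).

(** At each time one of the two answers is wrong, so the two error
    probabilities cannot both tend to 0. *)
Lemma parity_class_disjoint : [disjoint parity_class R false & parity_class R true].
Proof.
apply/disj_setPS => rho [[_ c0] [_ c1]] /=.
have mN i n : measurable [set x | parity_test n (initial_block n x) <> i].
  exact: (measurable_cylinder [set w | parity_test n w <> i]).
have : (rho [set x | parity_test n (initial_block n x) <> false] +
    rho [set x | parity_test n (initial_block n x) <> true])%E @[n --> \oo]
    --> (0 + 0)%E.
  by apply: cvgeD.
rewrite adde0 => c; suff : (1 <= 0 :> \bar R)%E by rewrite lee_fin ler10.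
apply: (cvge_ge _ c); apply: nearW => n.
rewrite -(probability_setT rho).
apply: le_trans; last exact: (measureU2 _ (mN false n) (mN true n)).
apply: le_measure; rewrite ?inE//; first exact: measurableU.
by move=> x _; case E : (parity_test n (initial_block n x)); [left|right]; rewrite /= E.
Qed.

Lemma full_pattern_class l (f : {mfun binary_sequence >-> bool}) : spaced l ->
  f = full_pattern l :> (_ -> _) -> parity_class R false (coded_law R f).
Proof.
move=> sp fE; split; first exact: coded_law_stationary_ergodic.
by have := @parity_error_cvg R l sp; rewrite -fE.
Qed.

Lemma cut_pattern_class l k (f : {mfun binary_sequence >-> bool}) : spaced_upto k l ->
  f = cut_pattern l k :> (_ -> _) -> parity_class R true (coded_law R f).
Proof.
move=> sp fE; split; first exact: coded_law_stationary_ergodic.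
apply: cvg_near_cst; near=> n; rewrite coded_lawE fE.
rewrite (_ : _ @^-1` _ = set0) ?measure0//; apply/seteqP; split=> z //=.
apply; rewrite /parity_test /= /odd_run_exponent (@run_exponent_cut_pattern _ k)//.
  by rewrite /= mul2n odd_double.
by near: n; exact: nbhs_infty_ge.
Unshelve. all: end_near.
Qed.

(** Periodicity makes the decision time uniform: there are finitely many
    starting points up to the period, each of positive probability. *)
Lemma decision_threshold phi l k : spaced_upto k l ->
    strongly_consistent (parity_class R false) (parity_class R true) phi ->
  exists N, forall n z, N <= n ->
    phi n (initial_block n (coding (cut_pattern l k) z)) = true.
Proof.
move=> sp strong; have [f fE] := mfun_of_measurable (measurable_cut_pattern sp).
have := strong true _ (cut_pattern_class sp fE); rewrite coded_lawE fE.
set E := _ @^-1` _ => E1.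
have EP z : E z = exists N, forall n, N <= n ->
    phi n (initial_block n (coding (cut_pattern l k) z)) = true by [].
have E_inv y z : residue (l k) y = residue (l k) z -> E y -> E z.
  by move=> yz; rewrite !EP (eq_coding_cut_pattern sp yz).
have mE : measurable E.
  by apply: (@measurable_finitary (l k)) => y z /eq_residueP; exact: E_inv.
have allE z : E z.
  apply: contrapT => nEz; pose C := [set y | residue (l k) y = residue (l k) z].
  have mC : measurable C.
    exact: (measurable_residue_set (l k) [set residue (l k) z]).
  have CE : C `<=` ~` E by move=> y /= yz Ey; apply: nEz; exact: E_inv Ey.
  have : (mu C <= mu (~` E))%E.
    by apply: le_measure; rewrite ?inE//; exact: measurableC.
  rewrite probability_setC// E1 subee// haar_residue ?residue_lt// lee_fin leNgt.
  by rewrite invr_gt0 exprn_gt0.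
suff [N HN] : exists N, forall n z, residue (l k) z < 2 ^ l k -> N <= n ->
    phi n (initial_block n (coding (cut_pattern l k) z)) = true.
  by exists N => n z; apply: HN; exact: residue_lt.
elim: (2 ^ l k) => [|m [N HN]]; first by exists 0.
have [[z zm]|none] := pselect (exists z, residue (l k) z = m).
  have [N' HN'] := allE z; exists (maxn N N') => n y; rewrite ltnS leq_eqVlt geq_max.
  move=> /orP[/eqP ym|ym] /andP[Nn N'n]; last exact: HN.
  by rewrite (eq_coding_cut_pattern sp (etrans ym (esym zm))); exact: HN'.
exists N => n y; rewrite ltnS leq_eqVlt => /orP[/eqP ym|]; last exact: HN.
by exfalso; apply: none; exists y.
Qed.

(** The scales are adapted to the test: stage [k.+1] only starts to show long
    after the test has decided on the pattern cut at stage [k]. *)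
Lemma exists_scales phi :
    strongly_consistent (parity_class R false) (parity_class R true) phi ->
  exists l N : nat -> nat, [/\ spaced l, forall k, l k <= N k,
    forall k, N k + 4 * k + 10 <= l k.+1 &
    forall k n z, N k <= n ->
      phi n (initial_block n (coding (cut_pattern l k) z)) = true].
Proof.
move=> strong.
pose P h t := last 0 h <= t /\ (spaced_upto (size h).-1 (nth 0 h) ->
  forall n z, t <= n ->
    phi n (initial_block n (coding (cut_pattern (nth 0 h) (size h).-1) z)) = true).
have /boolp.choice[T TP] : forall h, exists t, P h t.
  move=> h; rewrite /P.
  have [sp|nsp] := pselect (spaced_upto (size h).-1 (nth 0 h)).
    have [N HN] := decision_threshold sp strong.
    exists (maxn (last 0 h) N); rewrite leq_maxl; split=> // _ n z.
    by rewrite geq_max => /andP[_]; exact: HN.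
  by exists (last 0 h).
(* A nonempty history [h] ends with the scale of stage [(size h).-1]. *)
have [l lE] := exists_history_sequence
  (fun h => if h is [::] then 2 else T h + 4 * (size h).-1 + 10).
pose N k := T (mkseq l k.+1).
have l0 : l 0 = 2 by rewrite lE.
have lS k : l k.+1 = N k + 4 * k + 10.
  by rewrite lE /N; case E : (mkseq l k.+1) (size_mkseq l k.+1) => [//|x h] ->.
have lN k : l k <= N k.
  have [+ _] := TP (mkseq l k.+1).
  by rewrite (last_nth 0) size_mkseq /= (nth_mkseq 0 l (ltnSn k)).
have sp : spaced l.
  by move=> k; split=> [|j _]; rewrite ?l0// lS; have := lN j; lia.
exists l, N; split=> // [k|k n z Nn]; first by rewrite lS.
have lh j : j <= k -> nth 0 (mkseq l k.+1) j = l j.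
  by move=> jk; rewrite nth_mkseq.
rewrite -(eq_cut_pattern lh); have [_] := TP (mkseq l k.+1).
rewrite size_mkseq; apply=> //; split; first by rewrite lh// l0.
by move=> j jk; rewrite !lh ?(ltnW jk)//; exact: (sp k).2.
Qed.

(** Almost every [z] lies in infinitely many odd halves. Unless it touches a later
    stage too early, the test then answers [true] at time [N k], and this for
    infinitely many [k]; but a strong test has to settle on [false]. Early
    touching has probability at most 1/2, which leaves a contradiction. *)
Lemma parity_class_no_strong_test :
  ~ exists phi,
      strongly_consistent (parity_class R false) (parity_class R true) phi.
Proof.
move=> [phi strong]; have [l [N [sp lN Nl HN]]] := exists_scales strong.
have [f fE] := mfun_of_measurable (measurable_full_pattern sp).
have := strong false _ (full_pattern_class sp fE); rewrite coded_lawE.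
set E := _ @^-1` _ => E1.
pose B := \bigcup_(j in [set j | 0 < j]) touched l (fun j => N j.-1) j.
pose Z := \bigcup_K [set z | forall k, K <= k -> ~~ odd_half l k z].
have NS k : N k <= N k.+1 by have := Nl k; have := lN k.+1; lia.
have Nmono : {homo N : j k / j <= k} by exact: homo_leq leqnn leq_trans NS.
have mB : measurable B.
  by apply: bigcup_measurable => j _; exact: measurable_touched.
have mZ K : measurable [set z | forall k, K <= k -> ~~ odd_half l k z].
  exact: measurable_missed_forever.
have E_sub : E `<=` B `|` Z.
  move=> z [M HM]; apply: contrapT => nBZ.
  have [k Mk zk] : exists2 k, M <= k & odd_half l k z.
    apply: contrapT => none; apply: nBZ; right; exists M => // k Mk.
    by apply/negP => zk; apply: none; exists k.
  have clz : clear_above l k (N k) z.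
    move=> j kj; have nt : ~ touched l (fun j => N j.-1) j z.
      by move=> tz; apply: nBZ; left; exists j => //=; lia.
    have : N k <= N j.-1 by apply: Nmono; lia.
    by move: nt; rewrite /touched /=; lia.
  have kN : k <= N k by have := spaced_ge k sp; have := lN k; lia.
  have := HM (N k) (leq_trans Mk kN).
  rewrite fE (initial_block_full_pattern clz) ?HN//.
  have := ltn_expl (N k) (ltnSn 1).
  move: zk; rewrite /odd_half.
  have r := rarity_le k; have Nk := Nl k.
  have -> : l k.+1 - rarity k = (l k.+1 - (rarity k).+1).+1 by lia.
  have : 2 ^ N k <= 2 ^ (l k.+1 - (rarity k).+1) by rewrite leq_exp2l//; lia.
  by rewrite expnS; lia.
have mUZ : measurable Z by exact: bigcupT_measurable.
have muB : (mu B <= (2 ^- 1)%:E)%E.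
  apply: haar_touched_tail => -[//|j] _ /=; have := Nl j; have := lN j.
  have [_ lj] := spaced_margin sp (ltn0Sn j); split=> //.
  by apply: leq_trans (ltnW (ltn_expl _ (ltnSn 1))) _; rewrite leq_exp2l//; lia.
have muZ : (mu Z <= 0)%E.
  have := measure_sigma_subadditive mu mZ mUZ (@subset_refl _ _).
  by rewrite eseries0// => i _ _; exact: haar_missed_forever.
have mE : measurable E.
  rewrite -[E]setTI.
  exact: (measurable_coding f measurableT (measurable_eventually phi false)).
have : (1 <= (2 ^- 1)%:E :> \bar R)%E.
  rewrite -E1 -[leRHS]adde0; apply: le_trans (leeD muB muZ).
  apply: (@le_trans _ _ (mu (B `|` Z))); last exact: measureU2.
  by apply: le_measure; rewrite ?inE//; exact: measurableU.
by rewrite lee_fin leNgt; lra.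
Qed.

End diagonal.

Theorem theorem1p2 (R : realType) :
  (exists H0 H1 : set (process_law R),
    [/\ H0 `<=` stationary_ergodic R, H1 `<=` stationary_ergodic R,
        [disjoint H0 & H1],
        exists phi : test, weakly_consistent H0 H1 phi
      & ~ exists phi : test, strongly_consistent H0 H1 phi])
  /\
  ~ (forall H0 H1 : set (process_law R),
       H0 `<=` stationary_ergodic R -> H1 `<=` stationary_ergodic R ->
       [disjoint H0 & H1] ->
       (exists phi : test, weakly_consistent H0 H1 phi) ->
       exists phi : test, strongly_consistent H0 H1 phi).
Proof.
have SE i : parity_class R i `<=` stationary_ergodic R by move=> rho [].
have weak : exists phi,
    weakly_consistent (parity_class R false) (parity_class R true) phi.
  by exists parity_test => -[] rho [].
split.
  exists (parity_class R false), (parity_class R true); split=> //.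
    exact: parity_class_disjoint.
  exact: parity_class_no_strong_test.
move=> H; apply: (@parity_class_no_strong_test R); apply: H => //.
exact: parity_class_disjoint.
Qed.
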